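(* When the signature is $(r,s)=(n-1,1)$, the affine chart ${}_2\mathcal U_{n-1,1}\subset\mathcal M$ is smooth over $O_F$ and isomorphic to $\mathbb A^{n-1}_{O_F}$.
   Context: Setting: $F_0$ complete discretely valued with ring of integers $O_{F_0}$, uniformizer $\pi_0$, perfect residue field $k$ of characteristic $\neq2$; $F/F_0$ ramified quadratic with ring of integers $O_F$, uniformizer $\pi$, $\pi^2=\pi_0$. $V$ an $F$-vector space of dimension $n=2m>3$ with split $F/F_0$-hermitian form $\phi$ ($\phi(e_i,e_{n+1-j})=\delta_{ij}$), $(x,y)=\frac12\mathrm{Tr}_{F/F_0}\phi(x,y)$. $\Lambda_m=\mathrm{span}_{O_F}\{\pi^{-1}e_1,\dots,\pi^{-1}e_m,e_{m+1},\dots,e_n\}$, $t$ = multiplication by $\pi$. $\mathcal M$ is the projective $O_F$-scheme representing $S\mapsto\{(\mathcal F_0,\mathcal F_1)\}$, $\mathcal F_0\subset\mathcal F_1\subset\Lambda_m\otimes_{O_{F_0}}\mathcal O_S$ $\mathcal O_S$-submodules, Zariski locally direct summands of ranks $s,n$, with $\mathcal F_1^\perp=\mathcal F_1$ for $(\,,\,)\otimes\mathcal O_S$, $(t+\pi)\mathcal F_1\subset\mathcal F_0$, $(t-\pi)\mathcal F_0=0$. Let $g_1,\dots,g_{2n}$ be the $O_{F_0}$-basis $(-\pi^{-1}e_1,-e_1,-e_2,\dots,-e_m,\pi e_{m+1},\dots,\pi e_{n-1},e_n,\pi e_n,-\pi^{-1}e_2,\dots,-\pi^{-1}e_m,e_{m+1},\dots,e_{n-1})$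 of $\Lambda_m$, and $\Lambda'=\mathrm{span}_{O_{F_0}}(g_1,\dots,g_n)$. For $s=1$, ${}_2\mathcal U_{n-1,1}$ is the open subscheme of $\mathcal M$ of points such that the projection $\Lambda_m\otimes\mathcal O_S\to\bigoplus_{j=1}^{n}\mathcal O_Sg_j$ (kernel spanned by $g_{n+1},\dots,g_{2n}$) is an isomorphism on $\mathcal F_1$ and the $g_2$-coordinate map $\mathcal F_0\to\mathcal O_S$ is an isomorphism (an affine chart around $(\mathcal F_0,\Lambda'\otimes k)$). *)

(* Defs.v *)
From HB Require Import structures.
From mathcomp Require Import all_boot all_order all_algebra all_field.
From mathcomp Require Import sesquilinear ring_quotient.
From mathcomp Require Import mpoly.
From mathcomp Require Import zify.

Set Implicit Arguments.
Unset Strict Implicit.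
Unset Printing Implicit Defensive.

Import Order.TTheory GRing.Theory Num.Theory.
Local Open Scope ring_scope.

(* Normalised discrete valuations.  The value at 0 is meaningless, so every   *)
(* use below treats 0 apart (as if its valuation were +oo).                   *)

Record discrete_valuation (K : fieldType) := DiscreteValuation {
  dval :> K -> int;
  dvalM : forall x y, x != 0 -> y != 0 -> dval (x * y) = dval x + dval y;
  dvalD : forall x y, x != 0 -> y != 0 -> x + y != 0 ->
    Num.min (dval x) (dval y) <= dval (x + y);
  dval_onto : exists2 x, x != 0 & dval x = 1 }.

Definition val_ge (K : fieldType) (v : discrete_valuation K) (N : int) (x : K) :=
  (x == 0) || (N <= v x).

Definition complete_valuation (K : fieldType) (v : discrete_valuation K) :=
  forall u : nat -> K,
    (forall N, exists i0, forall i j, (i0 <= i)%N -> (i0 <= j)%N ->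
       val_ge v N (u i - u j)) ->
    exists l, forall N, exists i0, forall i, (i0 <= i)%N ->
       val_ge v N (u i - l).

Section ValuationRing.
Variables (K : fieldType) (v : discrete_valuation K).

Definition integers : {pred K} := [pred x | val_ge v 0 x].

Lemma dval1 : v 1 = 0.
Proof.
have /eqP := dvalM v (oner_neq0 K) (oner_neq0 K).
by rewrite mulr1 -[X in X == _]addr0 (inj_eq (addrI _)) => /eqP.
Qed.

Lemma dvalN x : x != 0 -> v (- x) = v x.
Proof.
have N1 : (-1 : K) != 0 by rewrite oppr_eq0 oner_neq0.
have vN1 : v (-1) = 0.
  have := dvalM v N1 N1; rewrite mulrNN mulr1 dval1 => /esym/eqP.
  by rewrite -mulr2n mulrn_eq0 /= => /eqP.
by move=> x0; rewrite -mulN1r dvalM // vN1 add0r.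
Qed.

Lemma val_geD N x y : val_ge v N x -> val_ge v N y -> val_ge v N (x + y).
Proof.
rewrite /val_ge; have [->|x0] /= := eqVneq x 0; first by rewrite add0r.
have [->|y0] /= := eqVneq y 0; first by rewrite addr0 (negPf x0).
have [//|xy0] /= := eqVneq (x + y) 0 => vx vy.
by apply: le_trans (dvalD v x0 y0 xy0); rewrite le_min vx vy.
Qed.

Lemma val_geN N x : val_ge v N x -> val_ge v N (- x).
Proof.
rewrite /val_ge oppr_eq0; have [//|x0] /= := eqVneq x 0.
by rewrite dvalN.
Qed.

Lemma val_geM N P x y : val_ge v N x -> val_ge v P y -> val_ge v (N + P) (x * y).
Proof.
rewrite /val_ge mulf_eq0; have [//|x0] /= := eqVneq x 0.
by have [//|y0] /= := eqVneq y 0 => ? ?; rewrite dvalM // lerD.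
Qed.

Lemma val_ge1 : val_ge v 0 1.
Proof. by rewrite /val_ge dval1 lexx orbT. Qed.

Fact integers_subring : subring_closed integers.
Proof.
split=> [|x y|x y]; rewrite !inE.
- exact: val_ge1.
- by move=> vx vy; apply/val_geD/val_geN.
- by move=> vx vy; rewrite -[0]addr0; apply: val_geM.
Qed.

HB.instance Definition _ :=
  GRing.isSubringClosed.Build K integers integers_subring.

Record int_ring := IntRing { int_val :> K; _ : int_val \in integers }.

HB.instance Definition _ := [isSub for int_val].
HB.instance Definition _ := [Choice of int_ring by <:].
HB.instance Definition _ := [SubChoice_isSubComNzRing of int_ring by <:].

Definition to_int (x : K) : int_ring := insubd 0 x.

Definition max_ideal : {pred int_ring} := [pred x | val_ge v 1 (val x)].

Fact max_ideal_idealr : idealr_closed max_ideal.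
Proof.
split=> [||a x y]; rewrite !inE.
- by rewrite /val_ge eqxx.
- by rewrite /val_ge rmorph1 oner_eq0 dval1.
- move=> vx vy; rewrite rmorphD rmorphM; apply: val_geD => //.
  by rewrite -[1]add0r; apply: val_geM => //; apply: valP a.
Qed.

HB.instance Definition _ := isIdealr.Build int_ring max_ideal max_ideal_idealr.

Definition residue_field : comNzRingType := {ideal_quot max_ideal}.

End ValuationRing.

Definition perfect (k : comNzRingType) :=
  forall p, p \in [pchar k] -> forall x : k, exists y, y ^+ p = x.

(* Schemes over O are handled through their points with values in commutative *)
(* O-algebras.  The zero ring is allowed, whence comPzRingType.               *)

Record algebra (O : comNzRingType) := Algebra {
  alg_sort :> comPzRingType;
  alg_map : {rmorphism O -> alg_sort} }.

Record alg_hom (O : comNzRingType) (A B : algebra O) := AlgHom {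
  alg_fun :> {rmorphism A -> B};
  alg_funE : forall c : O, alg_fun (alg_map A c) = alg_map B c }.

Program Definition alg_comp (O : comNzRingType) (A B C : algebra O)
    (h : alg_hom B C) (f : alg_hom A B) : alg_hom A C :=
  @AlgHom O A C (h \o f : {rmorphism A -> C}) _.
Next Obligation. by rewrite /= !alg_funE. Qed.

Definition poly_algebra (O : comNzRingType) (N : nat) : algebra O :=
  @Algebra O {mpoly O[N]} (@mpolyC N O).

Definition finitely_presented (O : comNzRingType) (A : algebra O) :=
  exists (N : nat) (q : alg_hom (poly_algebra O N) A)
         (r : nat) (f : 'I_r -> {mpoly O[N]}),
    (forall a, exists p, q p = a) /\
    (forall p, q p = 0 <-> exists c : 'I_r -> {mpoly O[N]},
                             p = \sum_i c i * f i).

Definition formally_smooth (O : comNzRingType) (A : algebra O) :=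
  forall (B C : algebra O) (q : alg_hom B C),
    (forall c, exists b, q b = c) ->
    (forall b b', q b = 0 -> q b' = 0 -> b * b' = 0) ->
    forall u : alg_hom A C, exists w : alg_hom A B, forall a, q (w a) = u a.

Definition smooth_algebra (O : comNzRingType) (A : algebra O) :=
  finitely_presented A /\ formally_smooth A.

Section Submodules.
Variables (R : comPzRingType) (N : nat).
Implicit Types P Q : 'rV[R]_N -> Prop.

Definition submodule P :=
  P 0 /\ forall (a : R) x y, P x -> P y -> P (a *: x + y).

Definition same_set P Q := forall x, P x <-> Q x.

Definition span P : 'rV[R]_N -> Prop := fun x =>
  exists (k : nat) (c : 'I_k -> R) (w : 'I_k -> 'rV[R]_N),
    (forall i, P (w i)) /\ x = \sum_i c i *: w i.

Definition free_of_rank (d : nat) P :=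
  exists b : 'M[R]_(d, N),
    injective (fun c : 'rV[R]_d => c *m b) /\
    (forall x, P x <-> exists c : 'rV[R]_d, x = c *m b).

Definition direct_summand P :=
  exists2 Q, submodule Q &
    (forall x, exists y z, [/\ P y, Q z & x = y + z]) /\
    (forall x, P x -> Q x -> x = 0).

End Submodules.

(* The image of P (x)_R S in S^N. *)
Definition base_change (R S : comPzRingType) (N : nat) (h : {rmorphism R -> S})
    (P : 'rV[R]_N -> Prop) : 'rV[S]_N -> Prop :=
  span (fun y => exists2 x, P x & y = map_mx h x).

Definition is_localization (R S : comPzRingType) (f : R)
    (h : {rmorphism R -> S}) :=
  [/\ exists g, h f * g = 1,
      forall s, exists a k, h f ^+ k * s = h a
    & forall a, h a = 0 -> exists k, f ^+ k * a = 0].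

Definition locally_summand (R : comPzRingType) (N d : nat)
    (P : 'rV[R]_N -> Prop) :=
  submodule P /\
  exists (k : nat) (f c : 'I_k -> R),
    \sum_i c i * f i = 1 /\
    forall i, exists (S : comPzRingType) (h : {rmorphism R -> S}),
      [/\ is_localization (f i) h, free_of_rank d (base_change h P)
        & direct_summand (base_change h P)].

(* Pairs of subsets of R^N, functorial in R by base change; an O-scheme       *)
(* parametrising pairs of submodules is given by the predicate that singles   *)
(* out its R-points among them, for every O-algebra R.                        *)

Definition set_pair (R : comPzRingType) (N : nat) : Type :=
  ('rV[R]_N -> Prop) * ('rV[R]_N -> Prop).

Definition same_pair (R : comPzRingType) (N : nat) (p q : set_pair R N) :=
  same_set p.1 q.1 /\ same_set p.2 q.2.

Definition base_change_pair (R S : comPzRingType) (N : nat)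
    (h : {rmorphism R -> S}) (p : set_pair R N) : set_pair S N :=
  (base_change h p.1, base_change h p.2).

Definition pair_scheme (O : comNzRingType) (N : nat) : Type :=
  forall R : algebra O, set_pair R N -> Prop.

(* X is isomorphic to Spec A: there is a bijection Hom_O(A, R) -> X(R) that   *)
(* is natural in R.                                                           *)
Definition iso_Spec (O : comNzRingType) (N : nat) (X : pair_scheme O N)
    (A : algebra O) :=
  exists beta : forall R : algebra O, alg_hom A R -> set_pair R N,
    [/\ forall (R S : algebra O) (h : alg_hom R S) (u : alg_hom A R),
          same_pair (beta S (alg_comp h u)) (base_change_pair h (beta R u)),
        forall (R : algebra O) (u w : alg_hom A R),
          same_pair (beta R u) (beta R w) <-> u =1 w
      & forall (R : algebra O) (p : set_pair R N),
          X R p <-> exists u : alg_hom A R, same_pair (beta R u) p].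

Definition smooth_affine (O : comNzRingType) (N : nat) (X : pair_scheme O N) :=
  exists2 A : algebra O, iso_Spec X A & smooth_algebra A.

Definition iso_affine_space (O : comNzRingType) (N : nat)
    (X : pair_scheme O N) (d : nat) :=
  iso_Spec X (poly_algebra O d).

Section LocalModel.
Variables (F0 : fieldType) (F : fieldExtType F0) (v : discrete_valuation F).
Variables (pi : F) (conj : {rmorphism F -> F}) (m : nat).
Variables (V : vectType F) (phi : V -> V -> F).
Variable e : (2 * m).-tuple V.
Local Notation n := (2 * m)%N.
Local Notation O_F := (int_ring v).

(* 1-based: e_ i is the vector e_i, for 1 <= i <= n. *)
Definition e_ (i : nat) : V := nth 0 e i.-1.

(* (x, y) = 1/2 Tr_{F/F0} phi(x, y), as an element of F0 inside F. *)
Definition trform (x y : V) : F := (phi x y + conj (phi x y)) / 2.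

Definition gseq : seq V :=
  [:: - (pi^-1 *: e_ 1); - e_ 1]
  ++ [seq - e_ i | i <- iota 2 m.-1]
  ++ [seq pi *: e_ i | i <- iota m.+1 m.-1]
  ++ [:: e_ n; pi *: e_ n]
  ++ [seq - (pi^-1 *: e_ i) | i <- iota 2 m.-1]
  ++ [seq e_ i | i <- iota m.+1 m.-1].

(* 0-based: g_ i is the vector g_{i+1}.  As g is an O_{F0}-basis of Lambda_m, *)
(* Lambda_m (x)_{O_{F0}} R is 'rV[R]_(n + n), in coordinates along g; the     *)
(* entries of the two matrices below lie in O_{F0}, but are only needed as    *)
(* elements of O_F, since every R is an O_F-algebra.                          *)
Definition g_ (i : nat) : V := nth 0 gseq i.

Definition gram : 'M[O_F]_(n + n) :=
  \matrix_(i, j) to_int v (trform (g_ i) (g_ j)).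

(* t g_ i = pi ^+ k g_ j, with k = 0 or 2, for (j, k) = t_image i. *)
Definition t_image (i : nat) : nat * nat :=
  if i == 0%N then (1, 0)%N else if i == 1%N then (0, 2)%N
  else if (i < n)%N then (n + i, 2)%N
  else if i == n then (n.+1, 0)%N else if i == n.+1 then (n, 2)%N
  else (i - n, 0)%N.

Definition t_mx : 'M[O_F]_(n + n) :=
  \matrix_(i, j) if j == (t_image i).1 :> nat
                 then to_int v (pi ^+ (t_image i).2) else 0.

Lemma g_0 : g_ 0 = - (pi^-1 *: e_ 1). Proof. by []. Qed.

Lemma g_1 : g_ 1 = - e_ 1. Proof. by []. Qed.

Let size2 (x y : V) : size [:: x; y] = 2. Proof. by []. Qed.

Lemma g_lo i : (1 < i <= m)%N -> g_ i = - e_ i.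
Proof.
case/andP=> i1 im; rewrite /g_ /gseq nth_cat /= ltnNge i1 /=.
have lt : (i - 2 < m.-1)%N by lia.
by rewrite nth_cat size_map size_iota lt (nth_map 0%N) ?size_iota // nth_iota // subnKC.
Qed.

Lemma g_hi i : (1 < m)%N -> (m < i < n)%N -> g_ i = pi *: e_ i.
Proof.
move=> m1 /andP[im i_n]; rewrite /g_ /gseq.
do 2 (rewrite nth_cat ?size_map ?size_iota ?size2 ifF; last by lia).
rewrite nth_cat size_map size_iota ifT; last by lia.
rewrite (nth_map 0%N) ?size_iota ?nth_iota; try lia.
by congr (_ *: e_ _); lia.
Qed.

Lemma g_n : (1 < m)%N -> g_ n = e_ n.
Proof.
move=> m1; rewrite /g_ /gseq.
do 3 (rewrite nth_cat ?size_map ?size_iota ?size2 ifF; last by lia).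
by rewrite (_ : (n - 2 - m.-1 - m.-1 = 0)%N); last by lia.
Qed.

Lemma g_n1 : (1 < m)%N -> g_ n.+1 = pi *: e_ n.
Proof.
move=> m1; rewrite /g_ /gseq.
do 3 (rewrite nth_cat ?size_map ?size_iota ?size2 ifF; last by lia).
by rewrite (_ : (n.+1 - 2 - m.-1 - m.-1 = 1)%N); last by lia.
Qed.

Lemma g_nlo i : (1 < i <= m)%N -> g_ (n + i) = - (pi^-1 *: e_ i).
Proof.
case/andP=> i1 im; rewrite /g_ /gseq.
do 4 (rewrite nth_cat ?size_map ?size_iota ?size2 ifF; last by lia).
rewrite nth_cat size_map size_iota ifT; last by lia.
rewrite (nth_map 0%N) ?size_iota ?nth_iota; try lia.
by congr (- (_ *: e_ _)); lia.
Qed.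

Lemma g_nhi i : (1 < m)%N -> (m < i < n)%N -> g_ (n + i) = e_ i.
Proof.
move=> m1 /andP[im i_n]; rewrite /g_ /gseq.
do 5 (rewrite nth_cat ?size_map ?size_iota ?size2 ifF; last by lia).
rewrite (nth_map 0%N) ?size_iota ?nth_iota; try lia.
by congr (e_ _); lia.
Qed.

Lemma g_t_image i : (1 < m)%N -> pi != 0 -> (i < n + n)%N ->
  pi *: g_ i = pi ^+ (t_image i).2 *: g_ (t_image i).1.
Proof.
move=> m1 pi0 i_lt; rewrite /t_image.
have [->|i0] := eqVneq i 0%N.
  by rewrite g_0 g_1 /= expr0 scale1r scalerN scalerA divff // scale1r.
have [->|i1] := eqVneq i 1%N.
  by rewrite g_0 g_1 /= !scalerN scalerA expr2 mulfK.
have [i_n|n_i] := ltnP i n.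
  rewrite /=; have [im|mi] := leqP i m.
    rewrite g_lo ?g_nlo; try lia.
    by rewrite !scalerN scalerA expr2 mulfK.
  by rewrite g_hi ?g_nhi ?expr2 ?scalerA //; lia.
have [->|ni] := eqVneq i n; first by rewrite g_n // g_n1 // expr0 scale1r.
have [->|n1i] := eqVneq i n.+1; first by rewrite g_n // g_n1 // scalerA.
rewrite /= expr0 scale1r -{1}(subnKC n_i).
have [im|mi] := leqP (i - n) m.
  rewrite g_nlo ?g_lo; try lia.
  by rewrite scalerN scalerA divff // scale1r.
by rewrite g_nhi ?g_hi //; lia.
Qed.

Lemma t_mxE (i : 'I_(n + n)) : (1 < m)%N -> pi != 0 -> pi \in integers v ->
  pi *: g_ i = \sum_(j < n + n) val (t_mx i j) *: g_ j.
Proof.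
move=> m1 pi0 piO; rewrite g_t_image //.
have lt : ((t_image i).1 < n + n)%N.
  by case: i => i /= ilt; rewrite /t_image; do !case: ifP => ? /=; lia.
rewrite (bigD1 (Ordinal lt)) //= mxE eqxx insubdK; last exact: rpredX.
rewrite big1 ?addr0 // => j /negPf; rewrite -val_eqE /= => jF.
by rewrite mxE jF scale0r.
Qed.

Section Points.
Variable R : algebra O_F.
Local Notation Lambda := 'rV[R]_(n + n).

Definition piR : R := alg_map R (to_int v pi).

Definition formR (x y : Lambda) : R :=
  (x *m map_mx (alg_map R) gram *m y^T) 0 0.

Definition tR (x : Lambda) : Lambda := x *m map_mx (alg_map R) t_mx.

(* p = (F_0, F_1). *)
Definition local_model_points (s : nat) (p : set_pair R (n + n)) :=
  [/\ locally_summand s p.1 /\ locally_summand n p.2,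
      forall x, p.1 x -> p.2 x,
      forall x, p.2 x <-> (forall y, p.2 y -> formR x y = 0),
      forall x, p.2 x -> p.1 (tR x + piR *: x)
    & forall x, p.1 x -> tR x - piR *: x = 0].

End Points.

Definition local_model (s : nat) : pair_scheme O_F (n + n) :=
  fun R p => @local_model_points R s p.

Fact second_index_proof : (3 < n)%N -> (1 < n + n)%N.
Proof. by move=> h; rewrite (leq_trans (ltnW (ltnW h))) // leq_addr. Qed.

Definition second_index (hn : (3 < n)%N) : 'I_(n + n) :=
  Ordinal (second_index_proof hn).

(* lsubmx is the projection along g_{n+1}, ..., g_{2n} onto the span of       *)
(* g_1, ..., g_n.                                                             *)
Definition chart2 (hn : (3 < n)%N) : pair_scheme O_F (n + n) := fun R p =>
  [/\ local_model 1 p,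
      forall a : 'rV[R]_n, exists! x : 'rV[R]_(n + n), p.2 x /\ lsubmx x = a
    & forall a : R, exists! x : 'rV[R]_(n + n),
        p.1 x /\ x 0 (second_index hn) = a].

End LocalModel.

Arguments chart2 {F0 F} v pi conj {m V} phi e hn.

(* The entries of gram are not truncated by to_int. *)
Section Gram.
Variables (F0 : fieldType) (F : fieldExtType F0) (v : discrete_valuation F).
Variables (pi : F) (conj : {rmorphism F -> F}) (m : nat) (m1 : (1 < m)%N).
Variables (V : vectType F) (phi : {hermitian V for false & conj}).
Variable e : (2 * m).-tuple V.
Local Notation n := (2 * m)%N.
Hypotheses (two0 : (2 : F) != 0) (pi0 : pi != 0) (conj_pi : conj pi = - pi).
Hypothesis phi_split : forall i j : 'I_n,
  phi (tnth e i) (tnth e (rev_ord j)) = (i == j)%:R.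

Let phi_e a b : (0 < a <= n)%N -> (0 < b <= n)%N ->
  phi (e_ e a) (e_ e b) = (a + b == n.+1)%:R.
Proof.
move=> an bn; have la : (a.-1 < n)%N by lia.
have lb : (n - b < n)%N by lia.
have := phi_split (Ordinal la) (Ordinal lb).
rewrite !(tnth_nth 0) /= (_ : n - (n - b).+1 = b.-1)%N; last by lia.
move=> ->; congr (nat_of_bool _)%:R; rewrite -val_eqE /=; lia.
Qed.

Let g_form i : (i < n + n)%N -> exists a c, [/\ (0 < a <= n)%N,
  g_ pi e i = c *: e_ e a & if (a <= m)%N then c = - pi^-1 \/ c = -1
                            else c = 1 \/ c = pi].
Proof.
move=> i_lt.
have [->|i0] := eqVneq i 0%N.
  exists 1%N, (- pi^-1); rewrite g_0 -scaleNr; split=> //; first by lia.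
  by rewrite ltnW //; left.
have [->|i1] := eqVneq i 1%N.
  exists 1%N, (-1); rewrite g_1 scaleN1r; split=> //; first by lia.
  by rewrite ltnW //; right.
have [i_n|n_i] := ltnP i n.
  exists i; have [im|mi] := leqP i m.
    by exists (-1); rewrite g_lo ?scaleN1r; try lia; split=> //; [lia|right].
  by exists pi; rewrite g_hi; try lia; split=> //; [lia|right].
have [->|ni] := eqVneq i n.
  exists n, 1; rewrite g_n // scale1r; split=> //; first by lia.
  by rewrite ifF; [left|lia].
have [->|n1i] := eqVneq i n.+1.
  exists n, pi; rewrite g_n1 //; split=> //; first by lia.
  by rewrite ifF; [right|lia].
exists (i - n)%N; rewrite -{1 3}(subnKC n_i).
have [im|mi] := leqP (i - n) m.
  by exists (- pi^-1); rewrite g_nlo -?scaleNr; try lia; split=> //; [lia|left].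
by exists 1; rewrite g_nhi ?scale1r; try lia; split=> //; [lia|left].
Qed.

Lemma gramE (i j : 'I_(n + n)) :
  val (gram v pi conj phi e i j) = trform conj phi (g_ pi e i) (g_ pi e j).
Proof.
rewrite mxE insubdK // /trform.
have [a [c [an -> Hc]]] := g_form (ltn_ord i).
have [b [d [bn -> Hd]]] := g_form (ltn_ord j).
have -> : phi (c *: e_ e a) (d *: e_ e b) = c * conj d * (a + b == n.+1)%:R.
  by rewrite linearZl_LR linearZr_LR /= phi_e // mulrA.
rewrite rmorphM rmorph_nat -mulrDl.
have [ab|_] := eqVneq; last by rewrite mulr0 mul0r rpred0.
rewrite mulr1 !rmorphM /=.
have half1 : (1 + 1) / 2 \in integers v.
  by rewrite -[1 + 1]/(2%:R) divff ?rpred1.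
have halfN1 : (- 1 - 1) / 2 \in integers v.
  by rewrite -opprD mulNr rpredN.
have cjV : conj pi^-1 = - pi^-1 by rewrite fmorphV conj_pi invrN.
move: Hc Hd; rewrite (_ : (b <= m)%N = ~~ (a <= m)%N); last by lia.
by case: ifP => _ [] -> [] ->;
  rewrite ?(rmorph1, rmorphN, cjV, conj_pi, opprK, mulrN, mulNr, mul1r, mulr1,
            mulVf, divff, addNr, subrr, mul0r, rpred0) // ?rpred1.
Qed.

End Gram.

(* Main.v *)
(* Write a vector of Lambda_m (x) R as x = (a, b), along g_1, ..., g_n and     *)
(* g_{n+1}, ..., g_{2n}, with indices starting at 0 in each half.  On the      *)
(* chart F_0 is spanned by a vector w with second coordinate 1, and F_1 by the *)
(* rows of (1 | X).  Since (t - pi) w = 0, w is determined by its coordinates  *)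
(* a_2, ..., a_{n-1}, b_1, which are arbitrary.  Since (t + pi) F_1 is         *)
(* contained in F_0, w determines the columns of X of index >= 2; F_1 is       *)
(* isotropic iff X J is antisymmetric, where J is the (antisymmetric) pairing  *)
(* of the two halves, and this determines the other two columns because 2 is   *)
(* invertible.  All remaining conditions then hold identically, so these n - 1 *)
(* coordinates identify the chart with affine space.                           *)

From HB Require Import structures.
Require Import Defs.
From mathcomp Require Import all_boot all_order all_algebra all_field.
From mathcomp Require Import sesquilinear ring_quotient.
From mathcomp Require Import mpoly ring zify.

Set Implicit Arguments.
Unset Strict Implicit.
Unset Printing Implicit Defensive.

Import Order.TTheory GRing.Theory Num.Theory.
Local Open Scope ring_scope.

(** Over an [O_F]-algebra [R], the two bijectivity conditions of the chart say that F_0 has a unique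
    generator w with second coordinate 1, and F_1 a unique basis of the form (1 | X). The chart is
    thus cut out by equations in w and X, which [chart2P] solves over every [R]. The equation (t -
    pi) w = 0 groups the 2n coordinates of w in n pairs, one member being pi times the other; one
    pair is fixed by the normalisation, so n - 1 coordinates stay free ([eigenlineP]). The inclusion
    of (t + pi) F_1 in F_0 together with isotropy leaves a single X for each w
    ([lagrangian_unique]); here 2 must be regular. This X meets every condition ([lagrangian_skew],
    [lagrangian_shift], [line_in_lagrangian]): the only possible obstruction to F_0 lying in F_1 is
    a quadratic expression in w, which vanishes because J is antisymmetric. Isotropy improves to
    F_1^perp = F_1 because J is invertible ([graph_lagrangian]).

    So the points over [R] are the (n - 1)-tuples of elements of [R], compatibly with base change,
    and the chart is the spectrum of a polynomial algebra, which is smooth ([poly_algebra_smooth]).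
    The arithmetic of F/F_0 enters through the invertibility of 2 ([residue_char_neq2]), the
    relation conj pi = - pi ([conj_uniformizer]) and the resulting Gram matrix ([gram_polar]). *)

(** * Polynomial algebras: universal property and smoothness *)

Lemma poly_algebra_hom_ext (O : comNzRingType) (N : nat) (R : algebra O)
    (u w : alg_hom (poly_algebra O N) R) :
  (forall i, u 'X_i = w 'X_i) -> u =1 w.
Proof.
move=> uw; elim/mpolyind=> [|c mn p _ _ IH]; first by rewrite !rmorph0.
have uwC (d : O) : u d%:MP = w d%:MP.
  exact: etrans (alg_funE u d) (esym (alg_funE w d)).
rewrite !rmorphD IH -mul_mpolyC !rmorphM uwC mpolyXE_id !rmorph_prod.
congr (_ * _ + _); apply: eq_bigr => i _.
by rewrite !rmorphXn uw.
Qed.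

(* [mmap] needs a nontrivial target, so the zero ring is treated apart. *)
Lemma poly_algebra_hom (O : comNzRingType) (N : nat) (R : algebra O)
    (c : 'I_N -> R) :
  exists u : alg_hom (poly_algebra O N) R, forall i, u 'X_i = c i.
Proof.
case: R c => R a c; have [R0|R0] := eqVneq (1 : R) 0.
  have all0 (x y : R) : x = y by rewrite -[x]mulr1 -[y]mulr1 R0 !mulr0.
  pose z (_ : {mpoly O[N]}) : R := 0.
  have zB : zmod_morphism z by [].
  have zM : monoid_morphism z by split.
  pose z1 := GRing.isZmodMorphism.Build _ _ z zB.
  pose z2 := GRing.isMonoidMorphism.Build _ _ z zM.
  pose zz : {rmorphism {mpoly O[N]} -> R} := HB.pack z z1 z2.
  by exists (@AlgHom O (poly_algebra O N) (Algebra a) zz (fun _ => all0 _ _)) => i.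
pose nzR := GRing.PzSemiRing_isNonZero.Build R R0.
pose S : comNzRingType := HB.pack (GRing.ComPzRing.sort R) nzR.
pose f : {rmorphism {mpoly O[N]} -> S} := mmap (a : {rmorphism O -> S}) c.
have fC d : f d%:MP = a d by rewrite /f /= mmapC.
exists (@AlgHom O (poly_algebra O N) (Algebra a) f fC) => i.
by rewrite /= mmapX mmap1U.
Qed.

(** A homomorphism out of a polynomial algebra is a free choice of images of the variables, so it
    lifts along a surjection as soon as those images do. The presentation is the identity map with
    no relations. *)
Lemma poly_algebra_smooth (O : comNzRingType) (N : nat) :
  smooth_algebra (poly_algebra O N).
Proof.
split.
  have idC (d : O) : idfun (alg_map (poly_algebra O N) d)
                     = alg_map (poly_algebra O N) d by [].
  exists N, (@AlgHom O (poly_algebra O N) (poly_algebra O N) idfun idC).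
  exists 0%N, (fun _ => 0); split=> [a|p]; first by exists a.
  split=> [/= ->|[c ->]]; last by rewrite big_ord0.
  by exists (fun _ => 0); rewrite big_ord0.
move=> B C q q_onto _ u.
have [b qb] := fin_all_exists (fun i => q_onto (u 'X_i)).
have [w wb] := poly_algebra_hom b.
exists w; apply: (@poly_algebra_hom_ext _ _ _ (alg_comp q w)) => i.
by rewrite /= wb qb.
Qed.

(** * Submodules as row spaces of matrices normalised by a projection *)

Section RowSpaces.

Definition row_space (R : comPzRingType) (d N : nat) (b : 'M[R]_(d, N)) :
  'rV[R]_N -> Prop := fun x => exists c, x = c *m b.

(** Both sides are spanned by the images of the rows of [b]. This gives the naturality in [R] of the
    parametrisation of the chart. *)
Lemma row_space_base_change (R S : comPzRingType) (h : {rmorphism R -> S})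
    (d N : nat) (b : 'M[R]_(d, N)) :
  same_set (row_space (map_mx h b)) (base_change h (row_space b)).
Proof.
move=> x; split=> [[c ->]|[k [c [w [Hw ->]]]]].
  exists d, (fun i => c 0 i), (fun i => row i (map_mx h b)); split.
    by move=> i; exists (row i b); [exists (delta_mx 0 i); rewrite rowE|rewrite map_row].
  by rewrite mulmx_sum_row.
have Hy i : exists y : 'rV_d, w i = map_mx h (y *m b).
  by have [z [y ->] ->] := Hw i; exists y.
have {Hw Hy}[y Hy] := fin_all_exists Hy.
exists (\sum_i c i *: map_mx h (y i)); rewrite mulmx_suml.
by apply: eq_bigr => i _; rewrite Hy map_mxM scalemxAl.
Qed.

Variables (R : comPzRingType) (d N : nat) (r : 'M[R]_(N, d)).
Implicit Types (b : 'M[R]_(d, N)) (P : 'rV[R]_N -> Prop).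

Lemma row_spaceP b x : b *m r = 1%:M -> row_space b x <-> x = x *m r *m b.
Proof.
move=> br; split=> [[c ->]|xE]; last by exists (x *m r).
by rewrite -(mulmxA c) br mulmx1.
Qed.

(** A vector of the row space is recovered from its image under [r], and corresponding rows of [b]
    and [b'] have the same image. *)
Lemma row_space_inj b b' : b *m r = 1%:M -> b' *m r = 1%:M ->
  same_set (row_space b) (row_space b') -> b = b'.
Proof.
move=> br br' bb'; apply/row_matrixP => i.
have : row_space b' (row i b) by apply/bb'; exists (delta_mx 0 i); rewrite rowE.
move/(row_spaceP _ br') ->.
by rewrite -row_mul br !rowE mulmx1.
Qed.

Lemma row_space_exists_unique b P : b *m r = 1%:M ->
  same_set (row_space b) P -> forall a, exists! x, P x /\ x *m r = a.
Proof.
move=> br bP a; exists (a *m b); split.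
  by split; [apply/bP; exists a|rewrite -mulmxA br mulmx1].
by move=> x [/bP/(row_spaceP _ br) xE <-]; rewrite -xE.
Qed.

(** The rows of [b] are the preimages in [P] of the unit vectors. This turns each bijectivity
    condition of the chart into a normalised matrix. *)
Lemma exists_unique_row_space P : submodule P ->
    (forall a, exists! x, P x /\ x *m r = a) ->
  exists2 b, b *m r = 1%:M & same_set (row_space b) P.
Proof.
move=> [P0 Plin] Pr.
have Hw (i : 'I_d) : exists w : 'rV_N, P w /\ w *m r = delta_mx 0 i.
  by have [x [Hx _]] := Pr (delta_mx 0 i); exists x.
have {Hw}[w Hw] := fin_all_exists Hw.
pose b : 'M[R]_(d, N) := \matrix_i w i.
have br : b *m r = 1%:M.
  by apply/row_matrixP => i; rewrite row_mul rowK (Hw i).2 row1.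
have Pb c : P (c *m b).
  rewrite mulmx_sum_row; elim/big_ind: _ => //.
    by move=> x y Px Py; rewrite -[x]scale1r; apply: Plin.
  by move=> i _; rewrite rowK -[_ *: _]addr0; apply: Plin => //; apply: (Hw i).1.
exists b => // x; split=> [[c ->] //|Px].
apply/(row_spaceP _ br).
(* Both [x] and [x *m r *m b] lie in [P] and have the same image under [r], so uniqueness identifies
   them. *)
have [y [_ y_uniq]] := Pr (x *m r).
apply: etrans (esym (y_uniq x _)) (y_uniq _ _) => //.
by split=> //; rewrite -mulmxA br mulmx1.
Qed.

(** Such a submodule is free and a summand globally: the cover is the trivial localization at 1, and
    the complement is the kernel of [r]. *)
Lemma row_space_locally_summand b P : b *m r = 1%:M ->
  same_set (row_space b) P -> locally_summand d P.
Proof.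
move=> br bP.
have Psub : submodule P.
  split=> [|a x y /bP[c ->] /bP[c' ->]]; first by apply/bP; exists 0; rewrite mul0mx.
  by apply/bP; exists (a *: c + c'); rewrite mulmxDl scalemxAl.
split=> //; exists 1%N, (fun _ => 1), (fun _ => 1); rewrite big_ord1 mulr1.
split=> // _; exists R, idfun.
have idP : same_set (row_space b) (base_change idfun P).
  move=> x; rewrite -{1}(map_mx_id (frefl idfun) b).
  apply: iff_trans (row_space_base_change _ _ _) _.
  by split=> -[k [c [w [Hw ->]]]]; exists k, c, w; split=> // i;
    have [y /bP Hy ->] := Hw i; exists y.
split.
- split; first by exists 1; rewrite mulr1.
    by move=> s; exists s, 0%N; rewrite mul1r.
  by move=> a a0; exists 0%N; rewrite expr0 mul1r.
- exists b; split=> [c c' /= cc'|x]; last exact: iff_sym (idP x).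
  by rewrite -[c]mulmx1 -[c']mulmx1 -br !mulmxA cc'.
exists (fun x => x *m r = 0).
  split=> [|a x y xr yr]; first by rewrite mul0mx.
  by rewrite mulmxDl -scalemxAl xr yr scaler0 addr0.
split=> [x|x /idP[c ->]]; last by rewrite -mulmxA br mulmx1 => ->; rewrite mul0mx.
exists (x *m r *m b), (x - x *m r *m b); split; last by rewrite addrC subrK.
  by apply/idP; exists (x *m r).
by rewrite mulmxBl -!mulmxA br mulmx1 subrr.
Qed.

End RowSpaces.

(** * Index bookkeeping and the matrices of the pairing and of t *)

Section Coordinates.
Variable m : nat.
Local Notation n := (2 * m)%N.

(** For i > 1, [g_ i] and [g_ (n + i)] are multiples of e_i, which phi pairs with e_{n+1-i}. The
    vectors [g_ 0], [g_ 1] are multiples of e_1 and [g_ n], [g_ n.+1] of e_n; they pair crosswise,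
    since odd powers of pi have trace 0. *)
Definition dual_nat (i : nat) : nat :=
  if i == 0%N then 1%N else if i == 1%N then 0%N else (n.+1 - i)%N.

Fact dual_index_proof (i : 'I_n) : (dual_nat i < n)%N.
Proof. by case: i => i /= ilt; rewrite /dual_nat; do !case: ifP => ?; lia. Qed.

Definition dual_index (i : 'I_n) : 'I_n := Ordinal (dual_index_proof i).

Lemma dual_indexK : involutive dual_index.
Proof.
move=> i; apply: val_inj; case: i => -[|[|i]] //= ilt.
rewrite /dual_nat /=; do 2?[rewrite ifF; last by lia]; lia.
Qed.

Fact lower_index_proof (i : 'I_n) : (i.-1 < n - 1)%N.
Proof. by case: i => i /= ilt; lia. Qed.

(** The truncated predecessor sends 0 and 1 to the same index, so the coordinates b_0 = pi b_1 and
    b_1 of w both refer to y_0. *)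
Definition lower_index (i : 'I_n) : 'I_(n - 1) := Ordinal (lower_index_proof i).

Fact raise_index_proof (k : 'I_(n - 1)) : (k.+1 < n)%N.
Proof. by case: k => k /= klt; lia. Qed.

Definition raise_index (k : 'I_(n - 1)) : 'I_n := Ordinal (raise_index_proof k).

Lemma raise_indexK : cancel raise_index lower_index.
Proof. by move=> k; apply: val_inj. Qed.

Lemma lower_indexK (i : 'I_n) : (0 < i)%N -> raise_index (lower_index i) = i.
Proof. by move=> i_gt0; apply: val_inj; rewrite /= prednK. Qed.

Hypothesis m1 : (1 < m)%N.

Fact index0_proof : (0 < n)%N. Proof. lia. Qed.
Fact index1_proof : (1 < n)%N. Proof. lia. Qed.
Definition index0 : 'I_n := Ordinal index0_proof.
Definition index1 : 'I_n := Ordinal index1_proof.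
Local Notation i0 := index0.
Local Notation i1 := index1.

Variant index_spec (i : 'I_n) : bool -> bool -> Type :=
| Index0 of i = i0 : index_spec i true false
| Index1 of i = i1 : index_spec i false true
| IndexGt1 of (1 < i)%N : index_spec i false false.

Lemma indexP i : index_spec i (i == 0%N :> nat) (i == 1%N :> nat).
Proof.
case: i => -[|[|i]] ilt /=; constructor=> //; exact: val_inj.
Qed.

Lemma dual_index0 : dual_index i0 = i1. Proof. exact: val_inj. Qed.
Lemma dual_index1 : dual_index i1 = i0. Proof. exact: val_inj. Qed.
Lemma dual_index_gt1 (i : 'I_n) : (1 < i)%N -> (1 < dual_index i)%N.
Proof. by case: i => -[|[|i]] //= ilt _; rewrite /dual_nat /=; lia. Qed.

Lemma lower_index0 : lower_index i0 = lower_index i1.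
Proof. exact: val_inj. Qed.

Variable R : comPzRingType.
Implicit Types (p : R) (y : 'I_(n - 1) -> R) (X : 'M[R]_n).

Lemma sum_split (f : 'I_n -> R) :
  \sum_i f i = f i0 + f i1 + \sum_(i < n | (1 < i)%N) f i.
Proof.
rewrite (bigD1 i0) //= (bigD1 i1) //= addrA; congr (_ + _).
by apply: eq_bigl => i; rewrite -!val_eqE /=; case: (val i) => [|[|k]].
Qed.

Definition dual_sign (i : 'I_n) : R := if (i == 0%N :> nat) || (m < i)%N then 1 else -1.

Lemma dual_sign0 : dual_sign i0 = 1. Proof. by []. Qed.
Lemma dual_sign1 : dual_sign i1 = -1.
Proof. by rewrite /dual_sign /= ltnNge ltnW. Qed.

Lemma dual_sign_dual i : dual_sign (dual_index i) = - dual_sign i.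
Proof.
have [->|->|i1] := indexP i; first by rewrite dual_index0 dual_sign1.
  by rewrite dual_index1 dual_sign1 opprK.
rewrite /dual_sign; case: i i1 => i /= ilt i1; rewrite /dual_nat.
have -> : (i == 0%N) = false by lia.
have -> : (i == 1%N) = false by lia.
have -> : (n.+1 - i == 0)%N = false by lia.
have -> : (m < n.+1 - i)%N = ~~ (m < i)%N by lia.
by case: (m < i)%N => //=; rewrite opprK.
Qed.

Lemma dual_sign_sqr i : dual_sign i * dual_sign i = 1.
Proof. by rewrite /dual_sign; case: ifP => _; rewrite ?mulrNN mulr1. Qed.

(* g_{i+1} pairs with g_{n + j + 1} iff j = dual_index i.                     *)
Definition pairing_mx : 'M[R]_n :=
  \matrix_(i, j) if j == dual_index i then dual_sign i else 0.
Local Notation J := pairing_mx.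

Lemma pairing_mxT : J^T = - J.
Proof.
apply/matrixP => i j; rewrite !mxE.
rewrite -[i == _](inj_eq (can_inj dual_indexK)) dual_indexK eq_sym.
have [->|_] := eqVneq; last by rewrite oppr0.
by rewrite dual_sign_dual.
Qed.

Lemma mul_pairing_mx q (A : 'M_(n, q)) i j :
  (J *m A) i j = dual_sign i * A (dual_index i) j.
Proof.
rewrite mxE (bigD1 (dual_index i)) //= mxE eqxx big1 ?addr0 // => k /negPf ki.
by rewrite mxE ki mul0r.
Qed.

Lemma pairing_mxV : J *m J^T = 1%:M.
Proof.
apply/matrixP => i j; rewrite mul_pairing_mx !mxE (inj_eq (can_inj dual_indexK)).
by have [->|_] := eqVneq; rewrite ?dual_sign_sqr ?mulr0.
Qed.

Lemma skewP X : J *m X^T + X *m J^T = 0 <->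
  forall i j, dual_sign i * X j (dual_index i) + dual_sign j * X i (dual_index j) = 0.
Proof.
have E i j : (J *m X^T + X *m J^T) i j =
    dual_sign i * X j (dual_index i) + dual_sign j * X i (dual_index j).
  by rewrite mxE mul_pairing_mx mxE -[X *m J^T]trmxK trmx_mul trmxK [X in _ + X]mxE
             mul_pairing_mx mxE.
split=> [S i j|S]; first by rewrite -E S mxE.
by apply/matrixP => i j; rewrite E S mxE.
Qed.

(* The involution i -> dual_index i reverses the sign of each term.           *)
Lemma quadric_eq0 (z : 'I_n -> R) : (forall x : R, x + x = 0 -> x = 0) ->
  \sum_(i < n | (1 < i)%N) z i * (dual_sign i * z (dual_index i)) = 0.
Proof.
move=> two_inj; apply: two_inj.
rewrite [X in X + _](reindex_inj (can_inj dual_indexK)).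
rewrite (eq_bigl (fun i : 'I_n => (1 < i)%N)) => [|i].
  rewrite -big_split big1 // => i _ /=.
  by rewrite dual_indexK dual_sign_dual; ring.
by apply/idP/idP => /(@dual_index_gt1 _); rewrite ?dual_indexK.
Qed.

(* The matrix of t, with p standing for pi.                                   *)
Definition shift_mx p : 'M[R]_(n + n) :=
  \matrix_(i, j) if j == (t_image m i).1 :> nat then p ^+ (t_image m i).2 else 0.

(** The square of t is a scalar, so t permutes the lines of the basis by an involution. Each column
    of the matrix of t therefore has a single possibly nonzero entry. *)
Lemma t_imageK i : (i < n + n)%N -> (t_image m (t_image m i).1).1 = i.
Proof.
have n_gt1 : (1 < n)%N := index1_proof.
rewrite /t_image; move: n n_gt1 => N N1 iN.
have [->|ne0] := eqVneq i 0%N; first by [].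
have [->|ne1] := eqVneq i 1%N; first by [].
have [i_lt|i_ge] := ltnP i N.
  by rewrite /=; do 5?[rewrite ifF; last by lia]; rewrite /= addKn.
have [->|neN] := eqVneq i N.
  by rewrite /=; do 4?[rewrite ifF; last by lia]; rewrite eqxx.
have [->|neN1] := eqVneq i N.+1.
  by rewrite /=; do 3?[rewrite ifF; last by lia]; rewrite eqxx.
by rewrite /=; do 2?[rewrite ifF; last by lia]; rewrite ifT /=; lia.
Qed.

Lemma t_image_inj i j : (i < n + n)%N -> (j < n + n)%N ->
  (t_image m i).1 = (t_image m j).1 -> i = j.
Proof. by move=> ilt jlt eq_ij; rewrite -(t_imageK ilt) eq_ij t_imageK. Qed.

(** * Coordinates of t applied to a row *)

Section Shift.
Variables (p : R) (q : nat) (A : 'M[R]_(q, n + n)) (i : 'I_q).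
Local Notation T := (shift_mx p).

Lemma mul_shift_mx (k j : 'I_(n + n)) : j = (t_image m k).1 :> nat ->
  (A *m T) i j = p ^+ (t_image m k).2 * A i k.
Proof.
move=> jk.
have E l : T l j = if l == k then p ^+ (t_image m k).2 else 0.
  rewrite mxE jk; have [->|lk] := eqVneq l k; first by rewrite eqxx.
  rewrite ifF //; apply: contra_neqF lk => /eqP kl; apply: val_inj.
  exact: (t_image_inj (ltn_ord l) (ltn_ord k) (esym kl)).
rewrite mxE (bigD1 k) // E eqxx big1; first by rewrite Monoid.mulm1 mulrC.
by move=> l /negPf lk; rewrite E lk mulr0.
Qed.

Lemma shift_l0 : (A *m T) i (lshift n i0) = p ^+ 2 * A i (lshift n i1).
Proof. exact: (@mul_shift_mx (lshift n i1)). Qed.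

Lemma shift_l1 : (A *m T) i (lshift n i1) = A i (lshift n i0).
Proof. by rewrite (@mul_shift_mx (lshift n i0)) // mul1r. Qed.

Lemma shift_l (j : 'I_n) : (1 < j)%N -> (A *m T) i (lshift n j) = A i (rshift n j).
Proof.
case: j => j jlt /= j1; rewrite (@mul_shift_mx (rshift n (Ordinal jlt))) /t_image /=;
  do !(rewrite ifF; last by lia); rewrite ?mul1r //=; lia.
Qed.

Lemma shift_r0 : (A *m T) i (rshift n i0) = p ^+ 2 * A i (rshift n i1).
Proof.
rewrite (@mul_shift_mx (rshift n i1)) /t_image /=;
  do 4?[rewrite ifF; last by lia]; rewrite ifT //=; lia.
Qed.

Lemma shift_r1 : (A *m T) i (rshift n i1) = A i (rshift n i0).
Proof.
rewrite (@mul_shift_mx (rshift n i0)) /t_image /=;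
  do 3?[rewrite ifF; last by lia]; rewrite ifT ?mul1r //=; lia.
Qed.

Lemma shift_r (j : 'I_n) : (1 < j)%N -> (A *m T) i (rshift n j) = p ^+ 2 * A i (lshift n j).
Proof.
case: j => j jlt /= j1; rewrite (@mul_shift_mx (lshift n (Ordinal jlt))) /t_image /=;
  do 2!(rewrite ifF; last by lia); rewrite ifT //=; lia.
Qed.

End Shift.

(* The free coordinates y_0, ..., y_{n-2} are b_1, a_2, ..., a_{n-1}.         *)
Definition line_mx p y : 'rV[R]_(n + n) := row_mx
  (\row_j (if j == 0%N :> nat then p else if j == 1%N :> nat then 1
           else y (lower_index j)))
  (\row_j (if j == 1%N :> nat then y (lower_index j) else p * y (lower_index j))).

(* The matrix X of the header; i == 0 or i == 1 are the rows whose image under *)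
(* t + pi is w or pi w, the other rows being killed by t + pi.                 *)
Definition lagrangian_mx p y : 'M[R]_n := \matrix_(i, j)
  if i == 0%N :> nat then if j == 1%N :> nat then 0 else y (lower_index j)
  else if i == 1%N :> nat then
    if j == 0%N :> nat then 0
    else if j == 1%N :> nat then y (lower_index j) else p * y (lower_index j)
  else if j == 0%N :> nat then dual_sign i * (p * y (lower_index (dual_index i)))
  else if j == 1%N :> nat then - (dual_sign i * y (lower_index (dual_index i)))
  else - (p *+ (i == j)).

Definition graph_mx X : 'M[R]_(n, n + n) := row_mx 1%:M X.

(** The multiples of w that t + pi produces on the successive rows of (1 | X). *)
Definition eigen_col p : 'cV[R]_n :=
  \col_i if i == 0%N :> nat then 1 else if i == 1%N :> nat then p else 0.

(** * Solving for the generator w of F_0 and for the matrix X of F_1 *)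

Local Notation T p := (shift_mx p).

Lemma index01 : (i0 == i1) = false. Proof. by []. Qed.
Lemma index10 : (i1 == i0) = false. Proof. by []. Qed.
Lemma index0_gt1 (j : 'I_n) : (1 < j)%N -> (i0 == j) = false.
Proof. by rewrite -val_eqE /=; case: (val j). Qed.
Lemma index1_gt1 (j : 'I_n) : (1 < j)%N -> (i1 == j) = false.
Proof. by rewrite -val_eqE /=; case: (val j) => [|[]]. Qed.
Lemma gt1_index0 (j : 'I_n) : (1 < j)%N -> (j == i0) = false.
Proof. by rewrite eq_sym; apply: index0_gt1. Qed.
Lemma gt1_index1 (j : 'I_n) : (1 < j)%N -> (j == i1) = false.
Proof. by rewrite eq_sym; apply: index1_gt1. Qed.
Lemma gt1_neq0 (j : 'I_n) : (1 < j)%N -> (j == 0%N :> nat) = false.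
Proof. by case: (val j). Qed.
Lemma gt1_neq1 (j : 'I_n) : (1 < j)%N -> (j == 1%N :> nat) = false.
Proof. by case: (val j) => [|[]]. Qed.

Lemma dual_nat_neq0 (j : 'I_n) : (1 < j)%N -> (dual_nat j == 0%N) = false.
Proof. by move/dual_index_gt1/gt1_neq0. Qed.
Lemma dual_nat_neq1 (j : 'I_n) : (1 < j)%N -> (dual_nat j == 1%N) = false.
Proof. by move/dual_index_gt1/gt1_neq1. Qed.

Let indexE := (index01, index10, eqxx, mulr1n, mulr0n).

(** Coordinatewise, the eigenvector equation reads a_0 = pi a_1, b_0 = pi b_1 and b_j = pi a_j for j
    > 1, together with consequences of these; a_1 = 1 is the normalisation. *)
Lemma eigenlineP p (w : 'rV[R]_(n + n)) :
  w *m T p = p *: w /\ w 0 (lshift n i1) = 1 <-> exists y, w = line_mx p y.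
Proof.
split=> [[wT w1]|[y ->]]; last first.
  split; last by rewrite row_mxEl mxE.
  rewrite -[LHS]hsubmxK -[RHS]hsubmxK.
  congr row_mx; apply/rowP => j; rewrite [LHS]mxE [RHS]mxE [RHS]mxE.
    have [->|->|j1] := indexP j.
    - by rewrite shift_l0 !row_mxEl !mxE /=; ring.
    - by rewrite shift_l1 !row_mxEl !mxE /=; ring.
    by rewrite shift_l // row_mxEl row_mxEr !mxE gt1_neq0 ?gt1_neq1.
  have [->|->|j1] := indexP j.
  - by rewrite shift_r0 !row_mxEr !mxE /= -lower_index0; ring.
  - by rewrite shift_r1 !row_mxEr !mxE /= lower_index0.
  by rewrite shift_r // row_mxEl row_mxEr !mxE gt1_neq0 ?gt1_neq1 //; ring.
have wE j : p * w 0 j = (w *m T p) 0 j by rewrite wT mxE.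
exists (fun k => if raise_index k == 1%N :> nat then w 0 (rshift n (raise_index k))
                 else w 0 (lshift n (raise_index k))).
rewrite -[LHS]hsubmxK; congr row_mx; apply/rowP => j; rewrite !mxE.
  have [->|->|j1] := indexP j.
  - by rewrite -[RHS]mulr1 -w1 wE shift_l1.
  - exact: w1.
  by rewrite lower_indexK ?(ltnW j1) ?gt1_neq1.
have [->|->|j1] := indexP j.
- by rewrite lower_index0 lower_indexK //= wE shift_r1.
- by rewrite lower_indexK.
by rewrite lower_indexK ?(ltnW j1) ?gt1_neq1 ?wE ?shift_l.
Qed.

Lemma graph_mx_shift p X i j :
  (graph_mx X *m (T p + p%:M)) i j =
  (graph_mx X *m T p) i j + p * graph_mx X i j.
Proof. by rewrite mulmxDr mxE mul_mx_scalar [X in _ + X]mxE. Qed.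

(** The left-half coordinates of the equation for t + pi give the multipliers [c] and the columns of
    X of index at least 2; the antisymmetry of X J then gives column 1, and with it column 0. *)
Lemma lagrangian_unique p y X (c : 'cV[R]_n) :
    (forall x : R, x + x = 0 -> x = 0) ->
    graph_mx X *m (T p + p%:M) = c *m line_mx p y ->
    pairing_mx *m X^T + X *m pairing_mx^T = 0 ->
  X = lagrangian_mx p y.
Proof.
move=> two_inj cE /skewP skewX.
have E i j : (graph_mx X *m T p) i j + p * graph_mx X i j = c i 0 * line_mx p y 0 j.
  by rewrite -graph_mx_shift cE mxE big_ord1.
(* Since w has second coordinate 1, the multiplier of a row is the second coordinate of its image
   under t + pi. *)
have c_i i : c i 0 = eigen_col p i 0.
  have := E i (lshift n i1).
  rewrite shift_l1 !row_mxEl !mxE /= mulr1 => <-.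
  have [->|->|i_gt1] := indexP i.
  - by rewrite !indexE mulr0 addr0.
  - by rewrite !indexE add0r mulr1.
  by rewrite gt1_index0 ?gt1_index1 // mulr0 addr0.
(* For j > 1, t moves coordinate n + j to coordinate j, where column j of X becomes visible. *)
have Xj i (j : 'I_n) : (1 < j)%N -> X i j = eigen_col p i 0 * y (lower_index j) - p *+ (i == j).
  move=> j1; rewrite -c_i; have := E i (lshift n j).
  rewrite shift_l // row_mxEl row_mxEr [line_mx _ _ _ _]row_mxEl !mxE.
  rewrite (gt1_neq0 j1) (gt1_neq1 j1).
  by move=> <-; rewrite mulr_natr addrK.
(* Coordinate n + 1 ties column 0 to column 1, which antisymmetry has to settle. *)
have Xi0 k : X k i0 = eigen_col p k 0 * y (lower_index i1) - p * X k i1.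
  have := E k (rshift n i1).
  by rewrite -c_i shift_r1 !row_mxEr !mxE /= => <-; rewrite addrK.
(* A diagonal entry of the antisymmetry relation only says that twice this entry is 0. *)
have X01 : X i0 i1 = 0.
  by apply: two_inj; have := skewX i0 i0; rewrite dual_index0 dual_sign0 !mul1r.
have X00 : X i0 i0 = y (lower_index i1).
  by rewrite Xi0 X01 mxE mul1r mulr0 subr0.
have X11 : X i1 i1 = y (lower_index i1).
  have := skewX i0 i1; rewrite dual_index0 dual_index1 dual_sign0 dual_sign1.
  by rewrite mul1r mulN1r X00 => /subr0_eq.
have Xi1 (k : 'I_n) : (1 < k)%N -> X k i1 = - (dual_sign k * y (lower_index (dual_index k))).
  move=> k_gt1; have := skewX i0 k; rewrite dual_index0 dual_sign0 mul1r.
  have dk := dual_index_gt1 k_gt1.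
  by move/eqP; rewrite addr_eq0 => /eqP ->; rewrite Xj // mxE index0_gt1 // subr0 mul1r.
apply/matrixP => i j; rewrite [RHS]mxE.
have [->|->|i_gt1] := indexP i; have [->|->|j_gt1] := indexP j => //.
- by rewrite X00 lower_index0.
- by rewrite Xj // mxE index0_gt1 // subr0 mul1r.
- by rewrite Xi0 X11 mxE subrr.
- by rewrite Xj // mxE index1_gt1 // subr0.
- by rewrite Xi0 Xi1 // mxE gt1_neq0 ?gt1_neq1 //; ring.
- exact: Xi1.
by rewrite Xj // mxE gt1_neq0 ?gt1_neq1 // mul0r sub0r.
Qed.

Lemma lagrangian_skew p y :
  pairing_mx *m (lagrangian_mx p y)^T + lagrangian_mx p y *m pairing_mx^T = 0.
Proof.
apply/skewP => i j; rewrite !mxE.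
have [->|->|i_gt1] := indexP i; have [->|->|j_gt1] := indexP j;
  rewrite ?dual_index0 ?dual_index1 ?dual_sign0 ?dual_sign1 /=
    ?dual_nat_neq0 ?dual_nat_neq1 // ?lower_index0; try ring.
rewrite -[j == _](inj_eq (can_inj dual_indexK)) dual_indexK eq_sym.
have [->|_] := eqVneq; last by rewrite !mulr0n oppr0 !mulr0 addr0.
by rewrite dual_sign_dual mulr1n; ring.
Qed.

Lemma lagrangian_shift p y :
  graph_mx (lagrangian_mx p y) *m (T p + p%:M) = eigen_col p *m line_mx p y.
Proof.
apply/matrixP => i j; rewrite graph_mx_shift [RHS]mxE big_ord1.
case: (split_ordP j) => {}j ->.
  rewrite [graph_mx _ _ _]row_mxEl [line_mx _ _ _ _]row_mxEl.
  have [->|->|j_gt1] := indexP j.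
  - rewrite shift_l0 row_mxEl !mxE.
    by have [->|->|i_gt1] := indexP i;
       rewrite /= ?indexE ?gt1_index0 ?gt1_index1 //=; ring.
  - rewrite shift_l1 row_mxEl !mxE.
    by have [->|->|i_gt1] := indexP i;
       rewrite /= ?indexE ?gt1_index0 ?gt1_index1 //=; ring.
  rewrite shift_l // row_mxEr !mxE (gt1_neq0 j_gt1) (gt1_neq1 j_gt1).
  by have [->|->|i_gt1] := indexP i;
     case: (i == j);
     rewrite /= ?index0_gt1 ?index1_gt1 //=; ring.
rewrite [graph_mx _ _ _]row_mxEr [line_mx _ _ _ _]row_mxEr.
have [->|->|j_gt1] := indexP j.
- rewrite shift_r0 row_mxEr !mxE.
  by have [ei|ei|i_gt1] := indexP i; rewrite ?ei /= ?lower_index0; ring.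
- rewrite shift_r1 row_mxEr !mxE.
  by have [ei|ei|i_gt1] := indexP i; rewrite ?ei /= ?lower_index0; ring.
rewrite shift_r // row_mxEl !mxE (gt1_neq0 j_gt1) (gt1_neq1 j_gt1).
by have [->|->|i_gt1] := indexP i;
   case: (i == j);
     rewrite /= ?index0_gt1 ?index1_gt1 //=; ring.
Qed.

(** The coefficients of w along the rows of (1 | X) can only be its left half. Columns 0 and 1 then
    hold up to a multiple of the sum in [quadric_eq0], which is 0; the other columns agree term by
    term. *)
Lemma line_in_lagrangian p y : (forall x : R, x + x = 0 -> x = 0) ->
  line_mx p y = lsubmx (line_mx p y) *m graph_mx (lagrangian_mx p y).
Proof.
move=> two_inj; rewrite mul_mx_row mulmx1 row_mxKl; congr row_mx.
apply/rowP => j; rewrite [LHS]mxE [RHS]mxE sum_split !mxE /=.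
have [->|->|j_gt1] := indexP j.
- rewrite mulr0 addr0 lower_index0.
  have Q := quadric_eq0 (fun i => y (lower_index i)) two_inj.
  (* The vanishing sum, multiplied by [p], is added on the left to match column 0 termwise. *)
  rewrite -[LHS]addr0 -[X in _ + X](mulr0 p) -[in p * 0]Q mulr_sumr.
  congr (_ + _); apply: eq_bigr => i i_gt1.
  by rewrite !mxE (gt1_neq0 i_gt1) (gt1_neq1 i_gt1) /=; ring.
- have Q := quadric_eq0 (fun i => y (lower_index i)) two_inj.
  rewrite mulr0 add0r mul1r -[LHS]addr0 -[X in _ + X]oppr0 -[in - 0]Q -sumrN.
  congr (_ + _); apply: eq_bigr => i i_gt1.
  by rewrite !mxE (gt1_neq0 i_gt1) (gt1_neq1 i_gt1) /=; ring.
rewrite (bigD1 j) //= big1 => [|i /andP[i_gt1 /negPf ij]].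
  by rewrite !mxE (gt1_neq0 j_gt1) (gt1_neq1 j_gt1) eqxx mulr1n; ring.
by rewrite !mxE (gt1_neq0 i_gt1) (gt1_neq1 i_gt1) (gt1_neq0 j_gt1) (gt1_neq1 j_gt1)
           ij mulr0n; ring.
Qed.

Lemma eq_line_mx p y z : y =1 z -> line_mx p y = line_mx p z.
Proof. by move=> yz; congr row_mx; apply/rowP => j; rewrite !mxE yz. Qed.

Lemma eq_lagrangian_mx p y z : y =1 z -> lagrangian_mx p y = lagrangian_mx p z.
Proof. by move=> yz; apply/matrixP => i j; rewrite !mxE !yz. Qed.

Lemma line_mx_inj p y z : line_mx p y = line_mx p z -> y =1 z.
Proof.
move=> /eq_row_mx[/rowP yz_l /rowP yz_r] k; rewrite -(raise_indexK k).
have [|k1|k_gt1] := indexP (raise_index k); first by move/(congr1 val).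
  by have := yz_r i1; rewrite k1 !mxE.
by have := yz_l (raise_index k); rewrite !mxE (gt1_neq0 k_gt1) (gt1_neq1 k_gt1).
Qed.

End Coordinates.

(** * The symmetric form and Lagrangian graphs *)

Section Polarity.
Variables (m : nat) (m1 : (1 < m)%N) (R : comPzRingType).
Local Notation n := (2 * m)%N.
Local Notation J := (pairing_mx m R).

Definition polar_mx : 'M[R]_(n + n) := block_mx 0 J J^T 0.

Lemma pairing_mxVT : J^T *m J = 1%:M.
Proof. by rewrite -pairing_mxV pairing_mxT // mulNmx mulmxN. Qed.

Lemma polar_graph (X : 'M[R]_n) (x : 'rV[R]_(n + n)) :
  x *m polar_mx *m (graph_mx X)^T = lsubmx x *m J *m X^T + rsubmx x *m J^T.
Proof.
rewrite -{1}[x]hsubmxK mul_row_block !mulmx0 add0r addr0 tr_row_mx trmx1.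
by rewrite mul_row_col mulmx1 addrC.
Qed.

(** Isotropy is the antisymmetry of X J; maximality comes from the invertibility of J, which lets
    orthogonality to the rows of (1 | X) be solved for the right half of [x]. *)
Lemma graph_lagrangian (X : 'M[R]_n) : J *m X^T + X *m J^T = 0 ->
  forall x, row_space (graph_mx X) x <->
    forall y, row_space (graph_mx X) y -> (x *m polar_mx *m y^T) 0 0 = 0.
Proof.
move=> skewX x; split=> [[c ->] y [d ->]|x_perp].
  rewrite trmx_mul !mulmxA polar_graph mul_mx_row mulmx1 row_mxKl row_mxKr.
  by rewrite -(mulmxA c J) -(mulmxA c X) -mulmxDr skewX mulmx0 mul0mx mxE.
have xM : x *m polar_mx *m (graph_mx X)^T = 0.
  apply/rowP => j; rewrite [RHS]mxE -[RHS](x_perp (row j (graph_mx X))).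
    by rewrite !mxE; apply: eq_bigr => k _; rewrite !mxE.
  by exists (delta_mx 0 j); rewrite rowE.
exists (lsubmx x); rewrite -{1}[x]hsubmxK mul_mx_row mulmx1; congr row_mx.
(* For x = (a, b), orthogonality becomes (b - a X) J^T = 0, and multiplying by J gives b = a X. *)
move: xM; rewrite polar_graph -mulmxA (_ : J *m X^T = - (X *m J^T)).
  rewrite mulmxN mulmxA addrC -mulmxBl => /(congr1 (mulmx^~ J)).
  by rewrite /= -mulmxA pairing_mxVT mulmx1 mul0mx => /subr0_eq.
by apply/eqP; rewrite -addr_eq0 skewX.
Qed.

Lemma isotropic_skew (X : 'M[R]_n) :
    (forall x y, row_space (graph_mx X) x -> row_space (graph_mx X) y ->
       (x *m polar_mx *m y^T) 0 0 = 0) ->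
  J *m X^T + X *m J^T = 0.
Proof.
move=> isoX.
have rowX i : row_space (graph_mx X) (row i (graph_mx X)).
  by exists (delta_mx 0 i); rewrite rowE.
have -> : J *m X^T + X *m J^T = graph_mx X *m polar_mx *m (graph_mx X)^T.
  rewrite mul_row_block !mulmx0 add0r addr0 mul1mx tr_row_mx trmx1.
  by rewrite mul_row_col mulmx1 addrC.
apply/matrixP => i j; rewrite [RHS]mxE -[RHS](isoX _ _ (rowX i) (rowX j)).
by rewrite -!row_mul !mxE; apply: eq_bigr => k _; rewrite !mxE.
Qed.

End Polarity.

(** * The projections defining the chart, and base change of the matrices *)

Section Projections.
Variables (R : comPzRingType).

Definition left_proj (n1 n2 : nat) : 'M[R]_(n1 + n2, n1) := col_mx 1%:M 0.

Lemma mul_left_proj (q n1 n2 : nat) (A : 'M[R]_(q, n1 + n2)) :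
  A *m left_proj n1 n2 = lsubmx A.
Proof. by rewrite -{1}[A]hsubmxK mul_row_col mulmx1 mulmx0 addr0. Qed.

Definition coord_proj (N : nat) (k : 'I_N) : 'M[R]_(N, 1) := delta_mx k 0.

Lemma mul_coord_proj (N : nat) (k : 'I_N) (x : 'rV[R]_N) a :
  x *m coord_proj k = a <-> x 0 k = a 0 0.
Proof.
by rewrite -colE; split=> [<-|xk]; [|apply/colP => i; rewrite ord1]; rewrite mxE.
Qed.

End Projections.

Section MapMatrices.
Variables (m : nat) (R S : comPzRingType) (h : {rmorphism R -> S}).
Local Notation n := (2 * m)%N.

Lemma map_dual_sign (i : 'I_n) : h (dual_sign R i) = dual_sign S i.
Proof. by rewrite /dual_sign; case: ifP => _; rewrite ?rmorphN ?rmorph1. Qed.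

Lemma map_pairing_mx : map_mx h (pairing_mx m R) = pairing_mx m S.
Proof.
apply/matrixP => i j; rewrite !mxE.
by case: ifP => _; rewrite ?rmorph0 ?map_dual_sign.
Qed.

Lemma map_polar_mx : map_mx h (polar_mx m R) = polar_mx m S.
Proof.
by rewrite /polar_mx map_block_mx !map_mx0 -map_trmx map_pairing_mx.
Qed.

Lemma map_shift_mx p : map_mx h (shift_mx m p) = shift_mx m (h p).
Proof.
by apply/matrixP => i j; rewrite !mxE; case: ifP => _; rewrite ?rmorph0 ?rmorphXn.
Qed.

Lemma map_line_mx p (y : 'I_(n - 1) -> R) :
  map_mx h (line_mx p y) = line_mx (h p) (h \o y).
Proof.
rewrite map_row_mx; congr row_mx; apply/rowP => j; rewrite !mxE;
  by do !case: ifP => _; rewrite ?rmorphM ?rmorph1.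
Qed.

Lemma map_graph_lagrangian_mx p (y : 'I_(n - 1) -> R) :
  map_mx h (graph_mx (lagrangian_mx p y)) = graph_mx (lagrangian_mx (h p) (h \o y)).
Proof.
rewrite map_row_mx map_mx1; congr row_mx; apply/matrixP => i j; rewrite !mxE.
by do !case: ifP => _; rewrite ?(rmorphN, rmorphM, rmorphMn, rmorph0) ?map_dual_sign.
Qed.

End MapMatrices.

(** * Arithmetic of the ramified quadratic extension *)

Section IntegerRing.
Variables (F0 : fieldType) (v0 : discrete_valuation F0).
Variables (F : fieldExtType F0) (v : discrete_valuation F).
Hypothesis F_ramified : forall a : F0, a != 0 -> v (a%:A) = 2 * v0 a.

(** Since 2 is nonzero in the residue field, it has valuation 0 in [F0], hence also in [F], so its
    inverse is integral. *)
Lemma residue_char_neq2 : 2%N \notin [pchar (residue_field v0)] ->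
  (2 : F) != 0 /\ exists h : int_ring v, h + h = 1.
Proof.
move=> k_char.
have two_unit : ~~ val_ge v0 1 2.
  apply: contra k_char => two_max; rewrite inE /=.
  (* If 2 lay in the maximal ideal, its class in the residue field would be that of 0. *)
  have : (2%:R - 0 : int_ring v0) \in @max_ideal _ v0.
    by rewrite subr0 inE rmorph_nat.
  by rewrite Quotient.idealrBE rmorph_nat rmorph0.
have two_int : val_ge v0 0 2 by apply: (valP (2%:R : int_ring v0)).
have two0 : (2 : F0) != 0 by apply: contra two_unit; rewrite /val_ge => ->.
have v2 : v0 2 = 0.
  move: two_unit two_int; rewrite /val_ge (negPf two0) /= -ltNge => lt1 ge0.
  lia.
have two0F : (2 : F) != 0 by rewrite -(rmorph_nat (in_alg F)) fmorph_eq0.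
split=> //.
have half_int : (2^-1 : F) \in integers v.
  have v2F : v 2 = 0.
    by rewrite -(rmorph_nat (in_alg F)) /= F_ramified // v2 mulr0.
  have := dvalM v two0F (invr_neq0 two0F).
  rewrite divff // dval1 v2F add0r => v2V.
  by rewrite inE /= /val_ge -v2V lexx orbT.
exists (IntRing half_int); apply: val_inj; rewrite rmorphD rmorph1 /=.
by rewrite -mulr2n -[_ *+ 2]mulr_natl divff.
Qed.

Variables (pi0 : F0) (pi : F) (conj : {rmorphism F -> F}).
Hypotheses (F_quadratic : \dim {:F} = 2%N) (pi_uniformizer : v pi = 1).
Hypotheses (pi0_neq0 : pi0 != 0) (pi_sqr : pi ^+ 2 = pi0%:A).
Hypotheses (conj_F0 : forall a : F0, conj (a%:A) = a%:A).
Hypothesis conj_nontrivial : exists x, conj x != x.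

Lemma uniformizer_neq0 : pi != 0.
Proof.
apply: contra_neq pi0_neq0 => pi_eq0.
by apply: (fmorph_inj (in_alg F)); rewrite rmorph0 /= -pi_sqr pi_eq0 expr2 mul0r.
Qed.

Lemma uniformizer_integer : pi \in integers v.
Proof. by rewrite inE /= /val_ge pi_uniformizer orbT. Qed.

(* The valuation of pi is odd, so pi is not in F0 and F = F0 + F0 pi; hence    *)
(* conj pi = pi would make conj trivial.                                       *)
Lemma conj_uniformizer : conj pi = - pi.
Proof.
have : conj pi ^+ 2 == pi ^+ 2 by rewrite -rmorphXn pi_sqr conj_F0.
rewrite eqf_sqr => /orP[/eqP conj_pi|/eqP //].
have pi_notin : pi \notin 1%VS.
  apply/negP => /vlineP[a pi_a].
  have a0 : a != 0.
    by apply: contraNneq uniformizer_neq0 => a0; rewrite pi_a a0 scale0r.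
  by move: pi_uniformizer; rewrite pi_a F_ramified //; lia.
have F_sum : (1 + <[pi]> = fullv)%VS.
  apply/eqP; rewrite eqEdim subvf F_quadratic dimv_disjoint_sum ?dimv1.
    by rewrite dim_vline uniformizer_neq0.
  apply/eqP; rewrite capvC -subv0; apply/subvP => x.
  rewrite memv_cap => /andP[/vlineP[a ->]].
  have [->|a0] := eqVneq a 0; first by move=> _; rewrite scale0r mem0v.
  by move/(memvZ a^-1); rewrite scalerA mulVf // scale1r (negPf pi_notin).
have [x] := conj_nontrivial; have : x \in (1 + <[pi]>)%VS by rewrite F_sum memvf.
case/memv_addP=> _ /vlineP[a ->] [_ /vlineP[b ->] ->].
by rewrite rmorphD conj_F0 -[b *: pi]mulr_algl rmorphM conj_F0 conj_pi eqxx.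
Qed.

End IntegerRing.

(** * The Gram matrix in the basis g *)

Section GramMatrix.
Variables (F0 : fieldType) (F : fieldExtType F0) (v : discrete_valuation F).
Variables (pi : F) (conj : {rmorphism F -> F}) (m : nat) (m1 : (1 < m)%N).
Variables (V : vectType F) (phi : {hermitian V for false & conj}).
Variable e : (2 * m).-tuple V.
Local Notation n := (2 * m)%N.
Hypotheses (two0 : (2 : F) != 0) (pi0 : pi != 0) (conj_pi : conj pi = - pi).
Hypothesis phi_split : forall i j : 'I_n,
  phi (tnth e i) (tnth e (rev_ord j)) = (i == j)%:R.

Lemma t_mx_shift : pi \in integers v -> t_mx v pi m = shift_mx m (to_int v pi).
Proof.
move=> pi_int; apply/matrixP => i j; rewrite !mxE; case: ifP => // _.
by apply: val_inj; rewrite rmorphXn /= !insubdK // rpredX.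
Qed.

Lemma phi_e a b : (0 < a <= n)%N -> (0 < b <= n)%N ->
  phi (e_ e a) (e_ e b) = (a + b == n.+1)%:R.
Proof.
move=> an bn; have la : (a.-1 < n)%N by lia.
have lb : (n - b < n)%N by lia.
have := phi_split (Ordinal la) (Ordinal lb).
rewrite !(tnth_nth 0) /= (_ : n - (n - b).+1 = b.-1)%N; last by lia.
by move=> ->; congr (nat_of_bool _)%:R; rewrite -val_eqE /=; lia.
Qed.

Lemma trform_e c d a b : (0 < a <= n)%N -> (0 < b <= n)%N ->
  trform conj phi (c *: e_ e a) (d *: e_ e b) =
  if a + b == n.+1 then (c * conj d + conj (c * conj d)) / 2 else 0.
Proof.
move=> an bn; rewrite /trform linearZl_LR linearZr_LR /= phi_e // mulrA.
case: eqP => _; first by rewrite mulr1.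
by rewrite mulr0 rmorph0 addr0 mul0r.
Qed.

(** Each [g_ i] is a scalar times one e_a; label and scalar are recorded separately for the two
    halves of the basis. *)
Definition left_label (i : nat) : nat := if i == 0%N then 1%N else i.
Definition left_scalar (i : nat) : F :=
  if i == 0%N then - pi^-1 else if (i <= m)%N then -1 else pi.
Definition right_label (i : nat) : nat := if (i <= 1)%N then n else i.
Definition right_scalar (i : nat) : F :=
  if i == 0%N then 1 else if i == 1%N then pi else if (i <= m)%N then - pi^-1 else 1.

Lemma g_lshift (i : 'I_n) :
  g_ pi e (lshift n i) = left_scalar i *: e_ e (left_label i).
Proof.
case: i => i /= ilt; rewrite /left_scalar /left_label.
have [->|i0] := eqVneq i 0%N; first by rewrite g_0 scaleNr.
have [im|mi] := leqP i m; last by rewrite g_hi // mi.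
have [->|i1] := eqVneq i 1%N; first by rewrite g_1 scaleN1r.
by rewrite g_lo ?scaleN1r //; lia.
Qed.

Lemma g_rshift (i : 'I_n) :
  g_ pi e (rshift n i) = right_scalar i *: e_ e (right_label i).
Proof.
case: i => i /= ilt; rewrite /right_scalar /right_label.
have [->|i0] := eqVneq i 0%N; first by rewrite addn0 g_n // scale1r.
have [->|i1] := eqVneq i 1%N; first by rewrite addn1 g_n1.
have -> : (i <= 1)%N = false by lia.
have [im|mi] := leqP i m; last by rewrite g_nhi ?mi // scale1r.
by rewrite g_nlo ?scaleNr //; lia.
Qed.

Lemma conj_uniformizerV : conj pi^-1 = - pi^-1.
Proof. by rewrite fmorphV conj_pi invrN. Qed.

(** A pairing can be nonzero only between multiples c e_a and d e_b with a + b = n + 1, where it is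
    half the trace of c conj(d). Within each half this product is an odd power of pi up to sign, so
    the trace is 0; between dual indices of opposite halves it is 1 or -1. *)
Lemma gram_polar : gram v pi conj phi e = polar_mx m (int_ring v).
Proof.
have half2 : (1 + 1 : F) / 2 = 1 by rewrite -[1 + 1]/(2%:R) divff.
have halfN2 : (-1 - 1 : F) / 2 = -1 by rewrite -opprD mulNr half2.
have left_ok (i : 'I_n) : (0 < left_label i <= n)%N.
  by case: i => i /= ilt; rewrite /left_label; case: eqP; lia.
have right_ok (i : 'I_n) : (0 < right_label i <= n)%N.
  by case: i => i /= ilt; rewrite /right_label; case: ifP; lia.
have valJ i j : val (pairing_mx m (int_ring v) i j) =
    if j == dual_index i then dual_sign F i else 0.
  rewrite mxE; case: ifP => _; rewrite ?rmorph0 // /dual_sign.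
  by case: ifP => _; rewrite ?rmorphN rmorph1.
have eval_conj := (rmorph1 conj, @rmorphN _ _ conj, rmorphM conj, conj_uniformizerV, conj_pi,
  @opprK F, mulrN, mulNr, mul1r, mulr1, mulVf pi0, divff pi0, @addNr F, @subrr F, mul0r,
  half2, halfN2).
apply/matrixP => i j; apply: val_inj; rewrite (gramE v m1 two0 pi0 conj_pi phi_split).
case: (split_ordP i) => {}i ->; case: (split_ordP j) => {}j ->.
- rewrite !g_lshift trform_e // block_mxEul mxE rmorph0.
  case: i => i ilt; case: j => j jlt; rewrite /= /left_label /left_scalar.
  have [_|i0] := eqVneq i 0%N; have [_|j0] := eqVneq j 0%N;
    try (rewrite ifF //; lia).
  have [ij|//] := eqVneq (i + j)%N n.+1.
  have [im|mi] := leqP i m; have [jm|mj] := leqP j m; try lia;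
  by rewrite !eval_conj.
- rewrite g_lshift g_rshift trform_e // block_mxEur valJ -val_eqE /=.
  case: i => -[|[|i]] ilt; case: j => -[|[|j]] jlt;
    rewrite /= /left_label /left_scalar /right_label /right_scalar /dual_sign /dual_nat /=
      ?add1n ?eqxx ?(ltnW m1) ?(ltnNge m 1) ?(ltnW m1) /= ?eval_conj //.
  + by rewrite ifF //; lia.
  + by rewrite ifF //; lia.
  + by rewrite !ifF //; lia.
  + by rewrite !ifF //; lia.
  have [ij|ij] := eqVneq (i.+2 + j.+2)%N n.+1; last by rewrite ifF //; lia.
  rewrite [RHS]ifT; last by lia.
  by have [im|mi] := leqP i.+2 m; have [jm|mj] := leqP j.+2 m; try lia;
    rewrite !eval_conj.
- rewrite g_lshift g_rshift trform_e // block_mxEdl [X in val X]mxE valJ -val_eqE /=.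
  case: i => -[|[|i]] ilt; case: j => -[|[|j]] jlt;
    rewrite /= /left_label /left_scalar /right_label /right_scalar /dual_sign /dual_nat /=
      ?(ltnW m1) ?(ltnNge m 1) ?(ltnW m1) /= ?eval_conj //;
    try (rewrite ifT //; lia).
  + by rewrite !ifF //; lia.
  + by rewrite !ifF //; lia.
  + by rewrite ifF //; lia.
  + by rewrite ifF //; lia.
  have [ij|ij] := eqVneq (i.+2 + j.+2)%N n.+1; last by rewrite ifF //; lia.
  rewrite [RHS]ifT; last by lia.
  by have [im|mi] := leqP i.+2 m; have [jm|mj] := leqP j.+2 m; try lia;
    rewrite !eval_conj.
rewrite !g_rshift trform_e // block_mxEdr mxE rmorph0.
case: i => i ilt; case: j => j jlt; rewrite /= /right_label /right_scalar.
have [i1|i1] := leqP i 1; have [j1|j1] := leqP j 1; try (rewrite ifF //; lia).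
have [ij|//] := eqVneq (i + j)%N n.+1.
have -> : (i == 0%N) = false by lia.
have -> : (i == 1%N) = false by lia.
have -> : (j == 0%N) = false by lia.
have -> : (j == 1%N) = false by lia.
have [im|mi] := leqP i m; have [jm|mj] := leqP j m; try lia;
by rewrite !eval_conj.
Qed.

End GramMatrix.

(** * Points of the chart over an arbitrary algebra *)

Section ChartPoints.
Variables (F0 : fieldType) (F : fieldExtType F0) (v : discrete_valuation F).
Variables (pi : F) (conj : {rmorphism F -> F}) (m : nat) (m1 : (1 < m)%N).
Variables (V : vectType F) (phi : {hermitian V for false & conj}).
Variables (e : (2 * m).-tuple V) (n_gt3 : (3 < 2 * m)%N).
Local Notation n := (2 * m)%N.
Hypothesis gramE : gram v pi conj phi e = polar_mx m (int_ring v).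
Hypothesis t_mxE : t_mx v pi m = shift_mx m (to_int v pi).
Hypothesis half : exists h : int_ring v, h + h = 1.

Variable R : algebra (int_ring v).
Local Notation p := (piR pi R).
Local Notation i1 := (index1 m1).

Lemma two_regular (x : R) : x + x = 0 -> x = 0.
Proof.
have [h hh] := half => xx.
by rewrite -[x]mul1r -(rmorph1 (alg_map R)) -hh rmorphD mulrDl -mulrDr xx mulr0.
Qed.

Lemma formE (x y : 'rV[R]_(n + n)) :
  formR pi conj phi e x y = (x *m polar_mx m R *m y^T) 0 0.
Proof. by rewrite /formR gramE map_polar_mx. Qed.

Lemma tE (x : 'rV[R]_(n + n)) : tR pi x = x *m shift_mx m p.
Proof. by rewrite /tR t_mxE map_shift_mx. Qed.

Lemma second_indexE : second_index n_gt3 = lshift n i1.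
Proof. exact: val_inj. Qed.

(** The conditions on (F_0, F_1) become the equations on w and X solved in [eigenlineP] and
    [lagrangian_unique]; conversely, the explicit matrices satisfy all of them. *)
Lemma chart2P (P : set_pair R (n + n)) : chart2 v pi conj phi e n_gt3 R P <->
  exists y, same_set (row_space (line_mx p y)) P.1 /\
            same_set (row_space (graph_mx (lagrangian_mx p y))) P.2.
Proof.
have two_inj := two_regular.
have line_coord y : line_mx p y *m coord_proj R (lshift n i1) = 1%:M.
  by apply/mul_coord_proj; rewrite row_mxEl !mxE.
have graph_left (X : 'M[R]_n) : graph_mx X *m left_proj R n n = 1%:M.
  by rewrite mul_left_proj row_mxKl.
split=> [[[[sum1 sum2] sub perp tplus tminus] ex2 ex1]|[y [P1 P2]]].
  have ex2' a : exists! x, P.2 x /\ x *m left_proj R n n = a.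
    by have [x [Hx x_uniq]] := ex2 a; exists x; split=> [|z]; rewrite mul_left_proj //;
      exact: x_uniq.
  have ex1' a : exists! x, P.1 x /\ x *m coord_proj R (lshift n i1) = a.
    have [x [[Px xa] x_uniq]] := ex1 (a 0 0); rewrite second_indexE in xa x_uniq.
    exists x; split=> [|z [Pz /mul_coord_proj za]]; last exact: x_uniq.
    by split=> //; apply/mul_coord_proj.
  have [M Mleft PM] := exists_unique_row_space sum2.1 ex2'.
  have [w w1 Pw] := exists_unique_row_space sum1.1 ex1'.
  have rowM i : P.2 (row i M) by apply/PM; exists (delta_mx 0 i); rewrite rowE.
  have wP : P.1 w by apply/Pw; exists 1%:M; rewrite mul1mx.
  have [y wy] : exists y, w = line_mx p y.
    apply/(eigenlineP m1); split; last by move/mul_coord_proj: w1 ->; rewrite mxE.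
    by have := tminus _ wP; rewrite tE => /subr0_eq.
  (* The bijectivity condition on F_1 makes the left block of [M] the identity. *)
  have [X MX] : exists X, M = graph_mx X.
    exists (rsubmx M); rewrite -{1}[M]hsubmxK; congr row_mx.
    by rewrite -Mleft mul_left_proj.
  (* F_0 is generated by [w], so t + pi sends each row of [M] to a multiple of [w]; these multiples
     form the column [c]. *)
  have [c Mc] : exists c : 'cV[R]_n, M *m (shift_mx m p + p%:M) = c *m w.
    have Hc i : exists c : 'M[R]_1, row i M *m shift_mx m p + p *: row i M = c *m w.
      by have /Pw[c] := tplus _ (rowM i); rewrite tE; exists c.
    have {Hc}[c Hc] := fin_all_exists Hc.
    exists (\col_i c i 0 0); apply/row_matrixP => i.
    rewrite mulmxDr mul_mx_scalar linearD linearZ /= !row_mul Hc; congr (_ *m _).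
    by apply/rowP => k; rewrite !mxE !ord1.
  have skewX : pairing_mx m R *m X^T + X *m (pairing_mx m R)^T = 0.
    apply: isotropic_skew => x z; rewrite -MX => /PM Px /PM Pz.
    by rewrite -formE; apply: (perp x).1.
  exists y; rewrite wy in Pw Mc; rewrite MX in PM Mc.
  by rewrite -(lagrangian_unique m1 two_inj Mc skewX).
have wP1 c : P.1 (c *m line_mx p y) by apply/P1; exists c.
have lineP x : P.1 x -> x *m shift_mx m p = p *: x.
  move/P1=> [c ->].
  have [+ _] := (eigenlineP m1 p (line_mx p y)).2 (ex_intro _ y erefl).
  by rewrite -mulmxA => ->; rewrite scalemxAr.
split; first split.
- split; first exact: row_space_locally_summand (line_coord y) P1.
  exact: row_space_locally_summand (graph_left _) P2.
- move=> x /P1[c ->]; apply/P2; rewrite (line_in_lagrangian m1 p y two_inj) mulmxA.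
  by eexists.
- move=> x; apply: iff_trans (iff_sym (P2 x)) _.
  apply: iff_trans (graph_lagrangian m1 (lagrangian_skew m1 p y) x) _.
  by split=> H z /P2 /H; rewrite formE.
- move=> x /P2[c ->]; rewrite tE -mul_mx_scalar -mulmxDr -mulmxA.
  by rewrite lagrangian_shift // mulmxA.
- by move=> x /lineP; rewrite tE => ->; rewrite subrr.
- move=> a; have [x [Hx x_uniq]] := row_space_exists_unique (graph_left _) P2 a.
  by exists x; split=> [|z]; rewrite -mul_left_proj //; apply: x_uniq.
move=> a.
have [x [[Px /mul_coord_proj xa] x_uniq]] :=
  row_space_exists_unique (line_coord y) P1 a%:M.
rewrite second_indexE; exists x; split=> [|z [Pz za]].
  by rewrite xa mxE.
by apply: x_uniq; split=> //; apply/mul_coord_proj; rewrite za mxE.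
Qed.

End ChartPoints.

(** * Identification of the chart with affine space *)

Theorem theorem4p7
  (F0 : fieldType) (v0 : discrete_valuation F0)
  (F0_complete : complete_valuation v0)
  (k_perfect : perfect (residue_field v0))
  (k_char : 2%N \notin [pchar (residue_field v0)])
  (F : fieldExtType F0) (v : discrete_valuation F)
  (F_quadratic : \dim {:F} = 2%N)
  (F_ramified : forall a : F0, a != 0 -> v (a%:A) = 2 * v0 a)
  (pi0 : F0) (pi0_neq0 : pi0 != 0) (pi0_uniformizer : v0 pi0 = 1)
  (pi : F) (pi_uniformizer : v pi = 1) (pi_sqr : pi ^+ 2 = pi0%:A)
  (conj : {rmorphism F -> F})
  (conj_F0 : forall a : F0, conj (a%:A) = a%:A)
  (conj_nontrivial : exists x, conj x != x)
  (m : nat) (n_gt3 : (3 < 2 * m)%N)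
  (V : vectType F) (phi : {hermitian V for false & conj})
  (e : (2 * m).-tuple V) (e_basis : basis_of {:V} e)
  (phi_split : forall i j : 'I_(2 * m),
     phi (tnth e i) (tnth e (rev_ord j)) = (i == j)%:R) :
  smooth_affine (chart2 v pi conj phi e n_gt3) /\
  iso_affine_space (chart2 v pi conj phi e n_gt3) (2 * m - 1).
Proof.
have m1 : (1 < m)%N by lia.
have [two0 half] := residue_char_neq2 F_ramified k_char.
have pi_neq0 := uniformizer_neq0 pi0_neq0 pi_sqr.
have conj_pi := conj_uniformizer F_ramified F_quadratic pi_uniformizer pi0_neq0 pi_sqr
                  conj_F0 conj_nontrivial.
have gramE := gram_polar v m1 two0 pi_neq0 conj_pi phi_split.
have t_mxE := t_mx_shift m (uniformizer_integer pi_uniformizer).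
have chartP R := @chart2P _ _ v pi conj m m1 V phi e n_gt3 gramE t_mxE half R.
suff iso : iso_affine_space (chart2 v pi conj phi e n_gt3) (2 * m - 1).
  by split=> //; exists (poly_algebra (int_ring v) (2 * m - 1)) => //;
    apply: poly_algebra_smooth.
pose y (R : algebra (int_ring v))
  (u : alg_hom (poly_algebra (int_ring v) (2 * m - 1)) R) i := u 'X_i.
(* The images of the variables under [u] serve as the free coordinates of w. *)
exists (fun R u => (row_space (line_mx (piR pi R) (y R u)),
                    row_space (graph_mx (lagrangian_mx (piR pi R) (y R u))))).
split=> [R S h u|R u w|R P].
- have piS : piR pi S = h (piR pi R) by rewrite /piR alg_funE.
  split=> /= x; rewrite piS.
    by rewrite -[line_mx _ _]/(line_mx _ (h \o y R u)) -map_line_mx;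
       apply: row_space_base_change.
  by rewrite -[lagrangian_mx _ _]/(lagrangian_mx _ (h \o y R u)) -map_graph_lagrangian_mx;
     apply: row_space_base_change.
- split=> [[/= eq1 _]|uw]; last first.
    have yuw : y R u =1 y R w by move=> i; apply: uw.
    by split=> x /=; rewrite ?(eq_line_mx _ yuw) ?(eq_lagrangian_mx _ yuw).
  have line1 z : line_mx (piR pi R) z *m coord_proj R (lshift _ (index1 m1)) = 1%:M.
    by apply/mul_coord_proj; rewrite row_mxEl !mxE.
  (* F_0 alone determines the point: its normalised generator is unique, and the coordinates are
     read off from it. *)
  have lineE := row_space_inj (line1 _) (line1 _) eq1.
  by apply: poly_algebra_hom_ext; apply: (line_mx_inj m1 lineE).
apply: iff_trans (chartP R P) _; split=> [[z [P1 P2]]|[u [P1 P2]]]; last by exists (y R u).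
have [u uz] := poly_algebra_hom z; exists u.
by split=> x /=; rewrite ?(eq_line_mx _ uz) ?(eq_lagrangian_mx _ uz).
Qed.
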